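(* For every $n,r\ge 2$, we have $\dim C_r(\mathcal{N}_n)\ge (r+1)\dim\mathfrak{u}_P$.
   Context: $k$ is an algebraically closed field, $\mathfrak{gl}_n$ is the space of $n\times n$ matrices over $k$, $\mathcal{N}_n\subset\mathfrak{gl}_n$ is the variety of nilpotent matrices, and $C_r(\mathcal{N}_n)=\{(v_1,\ldots,v_r)\in(\mathcal{N}_n)^r : [v_i,v_j]=0 \text{ for all } i,j\}$. $P$ is the parabolic subgroup of $GL_n(k)$ corresponding to the partition $[m,m]$ if $n=2m$, or $[m+1,m]$ if $n=2m+1$, and $\mathfrak{u}_P$ is the Lie algebra of its unipotent radical: explicitly, the space of all block matrices $\begin{pmatrix} 0 & 0 \\ A & 0 \end{pmatrix}$ where $A$ is an arbitrary $m\times m$ matrix if $n=2m$, or an arbitrary $m\times(m+1)$ matrix if $n=2m+1$. Thus $\dim\mathfrak{u}_P=m^2$ if $n=2m$ and $\dim\mathfrak{u}_P=m(m+1)$ if $n=2m+1$. *)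

(* Defs.v *)
From HB Require Import structures.
From mathcomp Require Import all_boot all_order all_algebra.
From mathcomp Require Import boolp classical_sets constructive_ereal.
(* Not imported: its notations clash with those of classical_sets. *)
From mathcomp Require mpoly.

Set Implicit Arguments.
Unset Strict Implicit.
Unset Printing Implicit Defensive.

Import Order.TTheory GRing.Theory Num.Theory.
Local Open Scope classical_set_scope.
Local Open Scope ring_scope.

Section Zariski.
Variables (k : closedFieldType) (V : vectType k).

(* Polynomial functions on the affine space underlying V, in coordinates with
   respect to a basis of V; the algebra of all such functions, hence the Zariski
   topology, does not depend on the choice of basis. *)
Definition poly_eval (p : mpoly.mpoly (\dim {:V}) k) (v : V) : k :=
  mpoly.meval (fun j => coord (vbasis {:V}) j v) p.

Definition zero_locus (S : set (mpoly.mpoly (\dim {:V}) k)) : set V :=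
  [set v | forall p, S p -> poly_eval p v = 0].

Definition zariski_closed (F : set V) : Prop := exists S, F = zero_locus S.

(* Closedness in the subspace topology on X. *)
Definition closed_in (X Z : set V) : Prop :=
  exists2 F, zariski_closed F & Z = X `&` F.

Definition irreducible (Z : set V) : Prop :=
  Z !=set0 /\
  forall F G, closed_in Z F -> closed_in Z G -> Z = F `|` G ->
    Z = F \/ Z = G.

(* Z 0 < Z 1 < ... < Z d : a chain with d strict inclusions. *)
Definition irreducible_chain (X : set V) (d : nat) (Z : nat -> set V) : Prop :=
  (forall i, (i <= d)%N -> closed_in X (Z i) /\ irreducible (Z i)) /\
  (forall i, (i < d)%N -> Z i `<` Z i.+1).

(* The Krull dimension of X with its Zariski topology; it is -oo for the empty
   set, and would be +oo if the chains had unbounded length. *)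
Definition krull_dim (X : set V) : \bar int :=
  supremum -oo%E
    [set (d%:Z)%:E | d in [set d : nat | exists Z, irreducible_chain X d Z]].

End Zariski.

Section NilpotentCommutingVariety.
Variables (k : closedFieldType) (n : nat).

Definition nilpotent_mx : set 'M[k]_n := [set A | exists e : nat, A ^+ e = 0].

Definition lie_bracket (A B : 'M[k]_n) : 'M[k]_n := A *m B - B *m A.

Definition nilpotent_commuting_variety (r : nat) : set {ffun 'I_r -> 'M[k]_n} :=
  [set v | (forall i, nilpotent_mx (v i)) /\
           (forall i j, lie_bracket (v i) (v j) = 0)].

(* The block sizes are uphalf n and n./2, i.e. [m, m] for n = 2m and
   [m + 1, m] for n = 2m + 1. *)
Lemma uphalf_half_sum : (uphalf n + n./2 = n)%N.
Proof. by rewrite uphalf_half -addnA addnn odd_double_half. Qed.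

Definition lower_left_block (A : 'M[k]_(n./2, uphalf n)) : 'M[k]_n :=
  castmx (uphalf_half_sum, uphalf_half_sum)
    (block_mx (0 : 'M_(uphalf n, uphalf n)) 0 A 0).

Lemma lower_left_block_is_linear : linear lower_left_block.
Proof.
move=> a A B; apply/matrixP=> i j; rewrite !(castmxE, mxE).
by case: split => i'; rewrite !mxE; case: split => j'; rewrite !mxE ?mulr0 ?addr0.
Qed.

HB.instance Definition _ :=
  GRing.isLinear.Build k 'M[k]_(n./2, uphalf n) 'M[k]_n _
    lower_left_block lower_left_block_is_linear.

Definition uP : {vspace 'M[k]_n} := limg (linfun lower_left_block).

Lemma mem_uP (M : 'M[k]_n) : M \in uP <-> exists A, M = lower_left_block A.
Proof.
split=> [/memv_imgP[A _ ->]|[A ->]]; first by exists A; rewrite lfunE.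
by rewrite -[lower_left_block A]lfunE memv_img ?memvf.
Qed.

End NilpotentCommutingVariety.

(* Main.v *)
(* Conjugating tuples of block matrices [0, 0; A_i, 0] by unipotents [1, B; 0, 1]
   gives a polynomial map from the affine space of all (B, A_1, ..., A_r), of
   dimension (r + 1) dim u_P, to the nilpotent commuting variety. The closures of
   the images of a full flag of affine subspaces are irreducible, because any two
   points of such an image lie on a polynomial curve in it. For a suitable flag
   through a point with A_1 of full rank, an affine function vanishes on each image
   but not on the next one, so these closures form a strict chain. *)
From HB Require Import structures.
Require Import Defs.
From mathcomp Require Import all_boot all_order all_algebra.
From mathcomp Require Import boolp classical_sets constructive_ereal.
From mathcomp Require Import ring zify.
From mathcomp Require Import (canonicals) mpoly.

(** * Zariski closures, polynomial curves and chains of irreducible sets *)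

Section IrreducibleChains.
Import Order.TTheory GRing.Theory Num.Theory.
Local Open Scope classical_set_scope.
Local Open Scope ring_scope.
Set Implicit Arguments.
Unset Strict Implicit.
Unset Printing Implicit Defensive.
Variables (k : closedFieldType) (V : vectType k).

Lemma poly_eval_affine (l : {linear V -> k^o}) (c : k) :
  exists p, forall v : V, poly_eval p v = l v - c.
Proof.
exists (\sum_(j < \dim {:V}) (l (vbasis {:V})`_j : k) *: mpoly.mpolyX k (mpoly.mnm1 j)
        - mpoly.mpolyC _ c) => v.
rewrite /poly_eval mpoly.mevalB mpoly.mevalC raddf_sum /=; congr (_ - _).
rewrite [in RHS](coord_vbasis (memvf v)) linear_sum; apply: eq_bigr => j _.
by rewrite mpoly.mevalZ mpoly.mevalXU linearZ /= mulrC.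
Qed.

(** The list holds the vector coefficients of the curve, lowest degree first, so its coordinates are
    univariate polynomials in [t]. *)
Definition poly_curve (s : seq V) (t : k) : V :=
  \sum_(i < size s) t ^+ i *: s`_i.

Lemma poly_eval_curve (p : mpoly.mpoly (\dim {:V}) k) (s : seq V) :
  exists P : {poly k}, forall t, P.[t] = poly_eval p (poly_curve s t).
Proof.
exists (\sum_(m <- mpoly.msupp p) mpoly.mcoeff m p *: \prod_j
   (\poly_(i < size s) coord (vbasis {:V}) j s`_i) ^+ mpoly.fun_of_multinom m j).
move=> t; rewrite /poly_eval mpoly.mevalE horner_sum; apply: eq_bigr => m _.
rewrite hornerZ horner_prod; congr (_ * _); apply: eq_bigr => j _.
rewrite horner_exp horner_poly; congr (_ ^+ _).
rewrite linear_sum /=; apply: eq_bigr => i _.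
by rewrite linearZ /= mulrC.
Qed.

Definition zariski_closure (Y : set V) : set V :=
  zero_locus [set p | forall y, Y y -> poly_eval p y = 0].

Lemma sub_zariski_closure (Y : set V) : Y `<=` zariski_closure Y.
Proof. by move=> y Yy p; apply. Qed.

Lemma zariski_closure_mono (Y Y' : set V) :
  Y `<=` Y' -> zariski_closure Y `<=` zariski_closure Y'.
Proof. by move=> sYY' v Yv p Y'p; apply: Yv => y /sYY'; apply: Y'p. Qed.

Lemma closed_in_closure (X Y : set V) : closed_in X (X `&` zariski_closure Y).
Proof. by exists (zariski_closure Y) => //; eexists. Qed.

(** If neither closed piece contains [Y], some [p] and [q] from their equations are nonzero at
    points [x] and [y] of [Y]. Along a curve in [Y] from [x] to [y] both restrict to nonzero
    univariate polynomials, so some point of the curve avoids both pieces. *)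
Lemma irreducible_closure (X Y : set V) :
    Y `<=` X -> Y !=set0 ->
    (forall x y, Y x -> Y y -> exists s : seq V,
       [/\ poly_curve s 0 = x, poly_curve s 1 = y
         & forall t, Y (poly_curve s t)]) ->
  irreducible (X `&` zariski_closure Y).
Proof.
move=> sYX [y0 Yy0] curveY; set Z := X `&` _.
have sYZ : Y `<=` Z by move=> y Yy; split; [exact: sYX | exact: sub_zariski_closure].
split; first by exists y0; apply: sYZ.
move=> F G [_ [S ->] defF] [_ [T ->] defG] defZ.
have [YF | /existsNP[x /not_implyP[Yx /existsNP[p /not_implyP[Sp px]]]]] :=
  pselect (Y `<=` zero_locus S).
  left; rewrite defF; apply/seteqP; split=> [z Zz|z []//]; split=> // p Sp.
  by case: Zz => _; apply=> y /YF; apply.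
have [YG | /existsNP[y /not_implyP[Yy /existsNP[q /not_implyP[Tq qy]]]]] :=
  pselect (Y `<=` zero_locus T).
  right; rewrite defG; apply/seteqP; split=> [z Zz|z []//]; split=> // q Tq.
  by case: Zz => _; apply=> y /YG; apply.
have [s [s0 s1 Ys]] := curveY x y Yx Yy.
have [P defP] := poly_eval_curve p s; have [Q defQ] := poly_eval_curve q s.
have Pn0 : P != 0 by apply: contra_notN px => /eqP P0; rewrite -s0 -defP P0 horner0.
have Qn0 : Q != 0 by apply: contra_notN qy => /eqP Q0; rewrite -s1 -defQ Q0 horner0.
(* An algebraically closed field is infinite, so the nonzero product has a non-root. *)
have /closed_nonrootP[t] := mulf_neq0 Pn0 Qn0.
rewrite rootM negb_or !rootE defP defQ => /andP[/eqP pt /eqP qt].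
have: (F `|` G) (poly_curve s t) by rewrite -defZ; apply/sYZ/Ys.
by rewrite defF defG => -[[_ St]|[_ Tt]]; [case: pt; apply: St | case: qt; apply: Tt].
Qed.

(** The polynomial [l - c] vanishes on [Y], hence on its closure, but not at [v]. *)
Lemma closure_proper (X Y Y' : set V) (l : {linear V -> k^o}) (c : k) (v : V) :
    Y `<=` Y' -> (forall y, Y y -> l y = c) -> X v -> Y' v -> l v <> c ->
  X `&` zariski_closure Y `<` X `&` zariski_closure Y'.
Proof.
move=> sYY' lY Xv Y'v lv; split.
  by move=> w [Xw Yw]; split=> //; exact: zariski_closure_mono Yw.
have [p defp] := poly_eval_affine l c.
move=> sub; have [_ /(_ p) lvc] := sub v (conj Xv (sub_zariski_closure Y'v)).
rewrite defp in lvc; apply/lv/subr0_eq/lvc => y Yy.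
by rewrite defp lY ?subrr.
Qed.

Lemma krull_dim_ge (X : set V) (d : nat) (Z : nat -> set V) :
  irreducible_chain X d Z -> ((d : int)%:E <= krull_dim X)%E.
Proof.
move=> chainZ; rewrite /krull_dim /supremum; set D := [set e : nat | _].
have Dd : D d by exists Z.
pose DE : set (\bar int) := [set (e%:Z)%:E | e in D].
have DEd : DE (d%:Z)%:E by exists d.
rewrite -/DE ifF; last by apply/eqP => DE0; rewrite DE0 in DEd.
(* [supremum] falls back on [-oo] when no least upper bound exists, so one must be exhibited: the
   maximum if the lengths are bounded, [+oo] otherwise. *)
suff exm : exists m, supremums DE m by have [ub _] := xgetPex -oo%E exm; exact: ub.
have [[b bD]|unb] := pselect (exists b, forall e, D e -> (e <= b)%N).
  have exD : exists e, `[<D e>] by exists d; apply/asboolP.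
  have ubD e : `[<D e>] -> (e <= b)%N by move/asboolP; apply: bD.
  have [m /asboolP Dm maxm] := ex_maxnP exD ubD.
  exists (m%:Z)%:E; split=> [_ [e De <-]|u]; last by apply; exists m.
  by rewrite lee_fin lez_nat maxm //; apply/asboolP.
exists +oo%E; split=> [x _|u ubu]; first exact: leey.
case: u ubu => [b|//|] ubu; last by have := ubu _ (ex_intro2 _ _ d Dd erefl).
case: unb; exists `|b|%N => e De.
have := ubu _ (ex_intro2 _ _ e De erefl).
by rewrite lee_fin; lia.
Qed.

End IrreducibleChains.

Section ConjugatesOfBlocks.
Import Order.TTheory GRing.Theory Num.Theory.
Local Open Scope classical_set_scope.
Local Open Scope ring_scope.
Set Implicit Arguments.
Unset Strict Implicit.
Unset Printing Implicit Defensive.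
Variables (k : closedFieldType) (p q r : nat).
Hypothesis le_qp : (q <= p)%N.

(* Conjugating the block matrix [0, 0; A, 0] by [1, B; 0, 1] gives
   [B A, - B A B; A, - A B]. *)
Definition conj_block (B : 'M[k]_(p, q)) (A : 'M[k]_(q, p)) : 'M[k]_(p + q) :=
  col_mx B 1%:M *m A *m row_mx 1%:M (- B).

(** The inner factor [[1, - B] [B; 1]] is zero. This gives nilpotency and commutation at once. *)
Lemma conj_block_mul0 B A A' : conj_block B A *m conj_block B A' = 0.
Proof.
rewrite /conj_block -!mulmxA (mulmxA (row_mx _ _)) mul_row_col mul1mx mulmx1.
by rewrite subrr mul0mx !mulmx0.
Qed.

Lemma conj_block_ul B A a b :
  conj_block B A (lshift q a) (lshift q b) = (B *m A) a b.
Proof. by rewrite /conj_block mul_col_mx mul_col_row block_mxEul mulmx1. Qed.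

Lemma conj_block_dl B A a b :
  conj_block B A (rshift p a) (lshift q b) = A a b.
Proof. by rewrite /conj_block mul_col_mx mul_col_row block_mxEdl mulmx1 mul1mx. Qed.

Definition conj_blocks (B : 'M[k]_(p, q)) (A : 'I_r -> 'M[k]_(q, p)) :
  {ffun 'I_r -> 'M[k]_(p + q)} := [ffun i => conj_block B (A i)].

Lemma conj_blocks_in B A : @nilpotent_commuting_variety k (p + q) r (conj_blocks B A).
Proof.
split=> [i|i j]; last by rewrite /lie_bracket !ffunE !conj_block_mul0 subrr.
by exists 2%N; rewrite ffunE expr2 -[_ * _]/(_ *m _) conj_block_mul0.
Qed.

(** All three factors of [conj_block] are affine in [t], so the product is cubic; [s] lists its four
    coefficients. *)
Lemma conj_blocks_line (B B' : 'M[k]_(p, q)) (A A' : 'I_r -> 'M[k]_(q, p)) :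
  exists s : seq {ffun 'I_r -> 'M[k]_(p + q)}, forall t,
    poly_curve s t = conj_blocks (B + t *: B') (fun i => A i + t *: A' i).
Proof.
pose C0 := col_mx B (1%:M : 'M_q); pose C1 := col_mx B' (0 : 'M_q).
pose R0 := row_mx (1%:M : 'M_p) (- B); pose R1 := row_mx (0 : 'M_p) (- B').
exists [:: [ffun i => C0 *m A i *m R0];
  [ffun i => C1 *m A i *m R0 + C0 *m A' i *m R0 + C0 *m A i *m R1];
  [ffun i => C1 *m A' i *m R0 + C1 *m A i *m R1 + C0 *m A' i *m R1];
  [ffun i => C1 *m A' i *m R1]] => t.
apply/ffunP=> i; rewrite /poly_curve !big_ord_recl big_ord0 /= !ffunE /conj_block.
have -> : col_mx (B + t *: B') 1%:M = C0 + t *: C1.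
  by rewrite scale_col_mx add_col_mx scaler0 addr0.
have -> : row_mx 1%:M (- (B + t *: B')) = R0 + t *: R1.
  by rewrite scale_row_mx add_row_mx scaler0 addr0 opprD scalerN.
rewrite !mulmxDl !mulmxDr -!scalemxAr -!scalemxAl !mulmxDl -?scalemxAl.
move: (C0 *m A i *m R0) (C1 *m A i *m R0) (C0 *m A' i *m R0) (C0 *m A i *m R1).
move: (C1 *m A' i *m R0) (C1 *m A i *m R1) (C0 *m A' i *m R1) (C1 *m A' i *m R1).
by move=> M1 M2 M3 M4 M5 M6 M7 M8; apply/matrixP=> a b; rewrite !mxE /= /bump /=; ring.
Qed.

(** * The flag of affine parameter spaces and the images of its members *)

Hypothesis r_gt0 : (0 < r)%N.

(** Since [q <= p], component 0 is [[1, 0]], of full rank [q]: multiplying by it on the right loses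
    nothing of [B]. *)
Definition base_blocks (j : 'I_r) : 'M[k]_(q, p) :=
  if j == Ordinal r_gt0 then pid_mx q else 0.

(** The entries of [B] are numbered from 0, those of [A] from [p * q]. Coordinates numbered [i] or
    more are frozen at the base point [(0, base_blocks)]. *)
Definition in_flag (i : nat) (B : 'M[k]_(p, q)) (A : 'I_r -> 'M[k]_(q, p)) :=
  (forall x : 'I_p * 'I_q, (i <= enum_rank x)%N -> B x.1 x.2 = 0) /\
  (forall x : 'I_r * ('I_q * 'I_p), (i <= p * q + enum_rank x)%N ->
    A x.1 x.2.1 x.2.2 = base_blocks x.1 x.2.1 x.2.2).

Definition flag_image (i : nat) : set {ffun 'I_r -> 'M[k]_(p + q)} :=
  [set v | exists B A, in_flag i B A /\ v = conj_blocks B A].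

Lemma flag_imageS i : flag_image i `<=` flag_image i.+1.
Proof.
move=> _ [B [A [[hB hA] ->]]]; exists B, A; split=> //.
by split=> x hx; [apply: hB | apply: hA]; apply: ltnW.
Qed.

Lemma flag_image_in i : flag_image i `<=` @nilpotent_commuting_variety k (p + q) r.
Proof. by move=> _ [B [A [_ ->]]]; apply: conj_blocks_in. Qed.

Lemma flag_image_irreducible i :
  irreducible (@nilpotent_commuting_variety k (p + q) r `&`
               zariski_closure (flag_image i)).
Proof.
apply: irreducible_closure; first exact: flag_image_in.
  exists (conj_blocks 0 base_blocks), 0, base_blocks; split=> //.
  by split=> x _ //; rewrite mxE.
move=> _ _ [B [A [[hB hA] ->]]] [B' [A' [[hB' hA'] ->]]].
(* The segment between two parameters stays in the affine space [in_flag i]; its image is the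
   required curve. *)
have [s defs] := conj_blocks_line B (B' - B) A (fun i => A' i - A i).
exists s; split=> [||t]; rewrite defs.
- rewrite scale0r addr0; congr conj_blocks; apply/funext=> j.
  by rewrite scale0r addr0.
- rewrite scale1r addrC subrK; congr conj_blocks; apply/funext=> j.
  by rewrite scale1r addrC subrK.
exists (B + t *: (B' - B)), (fun i => A i + t *: (A' i - A i)); split=> //.
split=> x hx; rewrite !mxE ?hB ?hB' ?hA ?hA' //.
  by rewrite subrr mulr0 addr0.
by rewrite subrr mulr0 addr0.
Qed.

Definition entry (j : 'I_r) (a b : 'I_(p + q))
  (v : {ffun 'I_r -> 'M[k]_(p + q)}) : k^o := v j a b.

Lemma entry_is_linear j a b : linear (entry j a b).
Proof. by move=> c u v; rewrite /entry !ffunE !mxE. Qed.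

HB.instance Definition _ j a b :=
  GRing.isLinear.Build k {ffun 'I_r -> 'M[k]_(p + q)} k^o _
    (entry j a b) (entry_is_linear j a b).

Lemma mul_base_block (B : 'M[k]_(p, q)) a (b : 'I_q) :
  (B *m base_blocks (Ordinal r_gt0)) a (widen_ord le_qp b) = B a b.
Proof.
rewrite /base_blocks eqxx mxE (bigD1 b) //= big1 ?addr0 => [|c c_b].
  by rewrite mxE eqxx ltn_ord mulr1.
by rewrite mxE /= (inj_eq val_inj) (negPf c_b) mulr0.
Qed.

(* The B-coordinates grow first, with A = base_blocks fixed, so that B can be read
   off the upper left block of the component 0; then the A-coordinates grow, and
   these are read off the lower left blocks. *)
Lemma flag_image_proper i : (i < r.+1 * (p * q))%N ->
  @nilpotent_commuting_variety k (p + q) r `&` zariski_closure (flag_image i) `<`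
  @nilpotent_commuting_variety k (p + q) r `&` zariski_closure (flag_image i.+1).
Proof.
move=> lt_i; have [lt_ipq|le_pqi] := ltnP i (p * q).
  have lt_i' : (i < #|{: 'I_p * 'I_q}|)%N by rewrite card_prod !card_ord.
  (* [x] is the coordinate of [B] released between stages [i] and [i.+1]; [l] reads it off. *)
  pose x := enum_val (Ordinal lt_i').
  have rk_x : enum_rank x = i :> nat by rewrite enum_valK.
  have AE m B A : (m <= p * q)%N -> in_flag m B A -> A = base_blocks.
    move=> le_m [_ hA]; apply/funext=> j; apply/matrixP=> a b.
    by apply: (hA (j, (a, b))); apply: leq_trans (leq_addr _ _).
  pose l : {linear {ffun 'I_r -> 'M[k]_(p + q)} -> k^o} :=
    entry (Ordinal r_gt0) (lshift q x.1) (lshift q (widen_ord le_qp x.2)).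
  have lE B : l (conj_blocks B base_blocks) = B x.1 x.2.
    by rewrite /l /= /entry ffunE conj_block_ul mul_base_block.
  have fl : in_flag i.+1 (delta_mx x.1 x.2) base_blocks.
    split=> // y; rewrite mxE; case: andP => // -[/eqP y1 /eqP y2].
    by rewrite [y]surjective_pairing y1 y2 -surjective_pairing rk_x ltnn.
  apply: (@closure_proper _ _ _ _ _ l 0 (conj_blocks (delta_mx x.1 x.2) base_blocks)).
  - exact: flag_imageS.
  - move=> _ [B [A [BA ->]]]; rewrite (AE i B A (ltnW lt_ipq) BA) lE.
    by case: BA => /(_ x) hB _; apply: hB; rewrite rk_x.
  - exact: conj_blocks_in.
  - by exists (delta_mx x.1 x.2), base_blocks.
  - by rewrite lE mxE !eqxx; apply/eqP/oner_neq0.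
have lt_i' : (i - p * q < #|{: 'I_r * ('I_q * 'I_p)}|)%N.
  by rewrite !card_prod !card_ord (mulnC q) ltn_subLR // -mulSn.
pose x := enum_val (Ordinal lt_i').
have rk_x : enum_rank x = (i - p * q)%N :> nat by rewrite enum_valK.
pose l : {linear {ffun 'I_r -> 'M[k]_(p + q)} -> k^o} :=
    entry x.1 (rshift p x.2.1) (lshift q x.2.2).
have lE B A : l (conj_blocks B A) = A x.1 x.2.1 x.2.2.
  by rewrite /l /= /entry ffunE conj_block_dl.
(* The base point with only the newly released coordinate [x] raised by 1. *)
pose A1 j := base_blocks j + (j == x.1)%:R *: delta_mx x.2.1 x.2.2.
have fl1 : flag_image i.+1 (conj_blocks 0 A1).
  exists 0, A1; split=> //; split=> y; first by rewrite mxE.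
  rewrite /A1 !mxE -mulnb natrM.
  case: (y =P x) => [->|y_x _]; first by rewrite rk_x subnKC ?ltnn.
  suff -> : (y.1 == x.1)%:R * ((y.2.1 == x.2.1)%:R * (y.2.2 == x.2.2)%:R) = 0 :> k.
    by rewrite addr0.
  rewrite -!natrM !mulnb; case: and3P => // -[/eqP y1 /eqP y2 /eqP y3].
  by case: y_x; case: (y) (x) y1 y2 y3 => [? [? ?]] [? [? ?]] /= -> -> ->.
apply: (@closure_proper _ _ _ _ _ l (base_blocks x.1 x.2.1 x.2.2) (conj_blocks 0 A1)).
- exact: flag_imageS.
- move=> _ [B [A [[_ hA] ->]]]; rewrite lE; apply: hA.
  by rewrite rk_x subnKC.
- exact: conj_blocks_in.
- exact: fl1.
rewrite lE /A1 !mxE !eqxx mulr1 => /eqP.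
by rewrite -subr_eq0 addrAC subrr add0r oner_eq0.
Qed.

Lemma krull_dim_blocks_ge :
  (((r.+1 * (p * q))%N : int)%:E
     <= krull_dim (@nilpotent_commuting_variety k (p + q) r))%E.
Proof.
apply: (@krull_dim_ge _ _ _ _ (fun i => @nilpotent_commuting_variety k (p + q) r `&`
                                        zariski_closure (flag_image i))).
split=> [i _|]; last exact: flag_image_proper.
by split; [exact: closed_in_closure | exact: flag_image_irreducible].
Qed.

End ConjugatesOfBlocks.

(** * Comparison with the dimension of [uP] and the final bound *)

Lemma dim_uP_le (k : closedFieldType) (n : nat) :
  \dim (uP k n) <= uphalf n * n./2.
Proof.
have := limg_ker_dim (linfun (@lower_left_block k n)) fullv.
rewrite dimvf dim_matrix mulnC => dimE.
exact: leq_trans (leq_addl _ _) (eq_leq dimE).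
Qed.

Lemma half_le_uphalf (n : nat) : n./2 <= uphalf n.
Proof. by rewrite uphalf_half leq_addl. Qed.

Theorem corollary4p1p3 (k : closedFieldType) (n r : nat)
    (hn : (2 <= n)%N) (hr : (2 <= r)%N) :
  ((((r.+1 * \dim (uP k n))%N : int)%:E : \bar int)
     <= krull_dim (@nilpotent_commuting_variety k n r))%E.
Proof.
have := @krull_dim_blocks_ge k (uphalf n) n./2 r (half_le_uphalf n) (ltnW hr).
rewrite uphalf_half_sum; apply: Order.POrderTheory.le_trans.
by rewrite lee_fin lez_nat leq_mul2l dim_uP_le.
Qed.
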